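(* Let $n\ge 2$. For real numbers $0\le\theta_0\le\cdots\le\theta_{n-1}\le 2\pi$ with $\theta_0+\cdots+\theta_{n-1}\in 2\pi\mathbb Z$, let $t_\theta=\mathrm{diag}(e^{i\theta_0},\ldots,e^{i\theta_{n-1}})\in SU(n)$. The volume of the conjugacy class of $t_\theta$ in $SU(n)$, which up to a positive constant independent of $\theta$ is $$V(t_\theta)=\prod_{0\le j<k<n}\sin^2\left(\frac{\theta_k-\theta_j}{2}\right),$$ is maximized, among all such $\theta$, when the $n$ diagonal entries of $t_\theta$ are equally spaced around the unit circle, i.e. when $\theta_k=2\pi k/n$ for $k=0,\ldots,n-1$ if $n$ is odd, and when $\theta_k=\pi(2k+1)/n$ for $k=0,\ldots,n-1$ if $n$ is even.
   Context: $SU(n)$ is the group of unitary $n\times n$ complex matrices of determinant 1. For a compact connected Lie group with maximal torus $T$, the size (volume) of the conjugacy class of $t\in T$ is measured, up to a constant factor, by $V(t)=\prod_{\alpha}\sin^2(\alpha(\log t)/2)$, the product being over the positive roots $\alpha$. For $SU(n)$ with diagonal maximal torus the positive roots take the values $\theta_k-\theta_j$, $0\le j<k<n$, at $\log t_\theta$. *)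

(* Defs.v *)
From HB Require Import structures.
From mathcomp Require Import all_boot all_order all_algebra.
From mathcomp Require Import perm sesquilinear spectral.
From mathcomp Require Import complex.
From mathcomp Require Import all_classical all_reals all_analysis.

Set Implicit Arguments.
Unset Strict Implicit.
Unset Printing Implicit Defensive.

Import Order.TTheory GRing.Theory Num.Theory.
Local Open Scope classical_set_scope.
Local Open Scope ring_scope.

Definition expi (R : realType) (x : R) : R[i] := Complex (cos x) (sin x).

Definition SU (R : realType) (n : nat) : set 'M[R[i]]_n :=
  [set g | g \is unitarymx /\ \det g = 1].

(* On SU n, [invmx] is the group inverse, by [unitarymx_unit]. *)
Definition conj_class (R : realType) (n : nat) (t : 'M[R[i]]_n) :
    set 'M[R[i]]_n :=
  [set h | exists2 g, SU g & h = g *m t *m invmx g].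

Definition torus (R : realType) (n : nat) (theta : 'I_n -> R) : 'M[R[i]]_n :=
  diag_mx (\row_k expi (theta k)).

Definition admissible (R : realType) (n : nat) (theta : 'I_n -> R) : Prop :=
  [/\ forall k, 0 <= theta k <= 2 * pi,
      forall j k : 'I_n, (j <= k)%N -> theta j <= theta k
    & exists m : int, \sum_(k < n) theta k = 2 * pi * m%:~R].

Definition class_vol (R : realType) (n : nat) (theta : 'I_n -> R) : R :=
  \prod_(j < n) \prod_(k < n | (j < k)%N) sin ((theta k - theta j) / 2) ^+ 2.

Definition is_maximizer (R : realType) (n : nat) (F : ('I_n -> R) -> R)
    (theta0 : 'I_n -> R) : Prop :=
  admissible theta0 /\ forall theta, admissible theta -> F theta <= F theta0.

(* The diagonal entries, listed in some order [s], are
   [e^(i (a + 2 pi k / n))] for [k = 0, ..., n - 1]. *)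
Definition equally_spaced (R : realType) (n : nat) (t : 'M[R[i]]_n) : Prop :=
  exists (a : R) (s : {perm 'I_n}),
    forall k, t (s k) (s k) = expi (a + 2 * pi * k%:R / n%:R).

Definition spaced_angles (R : realType) (n : nat) (k : 'I_n) : R :=
  if odd n then 2 * pi * k%:R / n%:R else pi * (2 * k%:R + 1) / n%:R.
Arguments spaced_angles R n k : clear implicits.

(* A size function [vol] on sets of matrices which, on the conjugacy classes of
   the [torus theta], is [class_vol] up to a positive constant independent of
   [theta]. *)
Definition measures_classes (R : realType) (n : nat)
    (vol : set 'M[R[i]]_n -> R) : Prop :=
  exists2 c : R, 0 < c &
    forall theta : 'I_n -> R, admissible theta ->
      vol (conj_class (torus theta)) = c * class_vol theta.

Lemma expiD (R : realType) (x y : R) : expi (x + y) = expi x * expi y.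
Proof. by rewrite /expi cosD sinD [sin x * _ + _]addrC. Qed.

Lemma expi_2piz (R : realType) (m : int) : expi (2 * pi * m%:~R : R) = 1.
Proof.
have pos k : expi (2 * pi * k%:R : R) = 1.
  elim: k => [|k IH]; first by rewrite mulr0 /expi cos0 sin0.
  by rewrite -[k.+1%:R]natr1 mulrDr mulr1 expiD IH mul1r /expi mulr_natl cos2pi sin2pi.
case: m => m; first exact: pos.
rewrite NegzE mulrNz mulrN.
have := pos m.+1; rewrite /expi cosN sinN => -[-> ->].
by rewrite oppr0.
Qed.

Lemma torus_SU (R : realType) (n : nat) (theta : 'I_n -> R) :
  admissible theta -> SU (torus theta).
Proof.
move=> [_ _ [m sum_theta]]; split.
  apply/unitarymxP; rewrite /torus tr_diag_mx map_diag_mx mulmx_diag.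
  apply/matrixP => i j; rewrite !mxE.
  congr (_ *+ _); rewrite /expi.
  apply/eqP; rewrite eq_complex /=.
  by rewrite !mulrN opprK -!expr2 cos2Dsin2 eqxx /= [sin _ * _]mulrC addNr.
rewrite /torus det_diag -[RHS](expi_2piz R m) -sum_theta.
under eq_bigr => k _ do rewrite mxE.
apply/esym/(big_morph (@expi R) (@expiD R)).
by rewrite /expi cos0 sin0.
Qed.

(* Main.v *)
(** Since [|e^(ix) - e^(iy)|^2 = 4 sin^2((x - y)/2)], the product [class_vol theta]
    is, up to a positive constant, [|det V|^2 = det G], where [V] is the Vandermonde
    matrix of the diagonal entries of [torus theta] and [G] is [V] times its
    conjugate transpose.  All entries of [V] have modulus 1, so [G] has trace [n^2],
    and AM-GM on its eigenvalues gives [|det V|^2 <= n^n].  When the diagonal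
    entries are equally spaced, [G] is the scalar matrix [n], because its
    off-diagonal entries are sums over all [n]-th roots of unity of a nontrivial
    power; the bound is then attained. *)

Require Import Defs.
From mathcomp Require Import all_boot all_order all_algebra.
From mathcomp Require Import perm sesquilinear spectral ring lra.
From mathcomp Require Import complex.
From mathcomp Require Import all_classical all_reals all_analysis.

Import Order.TTheory GRing.Theory Num.Theory.
Local Open Scope ring_scope.
Local Open Scope sesquilinear_scope.

Lemma mulmx_trmxC_diag {C : numClosedFieldType} {m n : nat} (A : 'M[C]_(m, n)) i :
  (A *m A^t*) i i = \sum_j `|A i j| ^+ 2.
Proof. by rewrite mxE; apply: eq_bigr => j _; rewrite !mxE -normCK. Qed.

(** The Gram matrix is Hermitian, so it is unitarily diagonalizable; its determinant and trace are
    the product and the sum of the eigenvalues [D]. *)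
Lemma det_gram_le {C : numClosedFieldType} {n : nat} (A : 'M[C]_n) :
  \det (A *m A^t*) <= (\tr (A *m A^t*) / n%:R) ^+ n.
Proof.
set G := A *m A^t*; set P := spectralmx G; set D := spectral_diag G.
have Gherm : G^t* = G by rewrite trmx_mul map_mxM trmxCK.
have GE : G = invmx P *m diag_mx D *m P.
  by apply/orthomx_spectralP/normalmxP; rewrite Gherm.
have Punit : P \in unitmx := spectral_unit G.
(* [D] is itself the Gram matrix of [P *m A], so each eigenvalue is a sum of squared moduli, as
   AM-GM requires. *)
have diagE : diag_mx D = (P *m A) *m (P *m A)^t*.
  rewrite trmx_mul map_mxM -(invmx_unitary (spectral_unitarymx G)) -/P.
  rewrite mulmxA -(mulmxA P) -/G GE.
  by rewrite -!mulmxA mulmxV // mulmx1 mulmxA mulmxV // mul1mx.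
have D_ge0 i : 0 <= D 0 i.
  have /(congr1 (fun M : 'M[C]_n => M i i)) := diagE.
  rewrite mulmx_trmxC_diag mxE eqxx mulr1n => ->.
  by apply: sumr_ge0 => j _; rewrite exprn_ge0.
rewrite GE !det_mulmx mxtrace_mulC mulmxA mulmxV // mul1mx.
rewrite mulrAC -det_mulmx mulVmx // det1 mul1r det_diag mxtrace_diag.
have := @leif_AGM _ _ [pred _ | true] (fun i : 'I_n => D 0 i) (fun i _ => D_ge0 i).
by rewrite card_ord => AGM; exact: (leif_le AGM).
Qed.

Lemma det_gramC {C : numClosedFieldType} {n : nat} (A : 'M[C]_n) :
  \det (A *m A^t*) = `|\det A| ^+ 2.
Proof. by rewrite det_mulmx det_map_mx det_tr normCK. Qed.

Lemma sumr_ord {F : numFieldType} (n : nat) :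
  \sum_(k < n) (k%:R : F) = n%:R * (n%:R - 1) / 2.
Proof.
elim: n => [|n IH]; first by rewrite big_ord0 mul0r mul0r.
by rewrite big_ord_recr /= IH -natr1; field.
Qed.

Section TorusVandermonde.
Variable R : realType.
Implicit Types x y : R.

Lemma conj_expi x : (expi x)^* = expi (- x).
Proof. by rewrite /expi cosN sinN. Qed.

Lemma expi0 : expi (0 : R) = 1.
Proof. by rewrite /expi cos0 sin0. Qed.

Lemma expiX x m : expi x ^+ m = expi (x * m%:R).
Proof.
elim: m => [|m IH]; first by rewrite mulr0 expi0.
by rewrite exprS IH -expiD -natr1 mulrDr mulr1 addrC.
Qed.

Lemma norm_expiB x y :
  `|expi x - expi y| ^+ 2 = (4 * sin ((x - y) / 2) ^+ 2)%:C%C.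
Proof.
rewrite -add_Re2_Im2 /expi /=; congr (_ %:C)%C.
set d := (x - y) / 2.
have -> : x = y + (d + d) by rewrite /d; field.
rewrite !(cosD, sinD).
have := cos2Dsin2 y; have := cos2Dsin2 d.
move: (cos y) (sin y) (cos d) (sin d) => cy sy cd sd Hd Hy.
(* This is [|e^(iy)|^2 * |e^(2id) - 1|^2], with the double angles expanded. *)
transitivity ((cy ^+ 2 + sy ^+ 2) *
  ((1 - cd ^+ 2 + sd ^+ 2) ^+ 2 + 4 * sd ^+ 2 * cd ^+ 2)); first by ring.
have -> : cd ^+ 2 = 1 - sd ^+ 2 by rewrite -Hd; ring.
by rewrite Hy; ring.
Qed.

(** If [expi x = 1], the chord from [expi x] to 1 has length 0, so [sin (x / 2) = 0]; but [x / 2]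
    lies in [(0, pi)] up to sign. *)
Lemma expi_neq1 x : 0 < `|x| < 2 * pi -> expi x != 1.
Proof.
move=> /andP[x0 xpi]; apply/eqP => x1.
have := norm_expiB x 0; rewrite expi0 x1 subrr normr0 expr0n /= subr0.
move=> /(congr1 (@complex.Re R)) /= /esym/eqP.
rewrite mulf_eq0 pnatr_eq0 /= sqrf_eq0.
wlog x_ge0 : x x0 xpi {x1} / 0 <= x => [hw|].
  have [/hw|xlt0] := leP 0 x; first exact.
  by move=> s0; apply: (hw (- x)); rewrite ?normrN ?oppr_ge0 ?ltW // mulNr sinN oppr_eq0.
rewrite ger0_norm // in x0 xpi.
by rewrite gt_eqF // sin_gt0_pi //; apply/andP; split; lra.
Qed.

Definition torus_Vandermonde {n : nat} (theta : 'I_n -> R) : 'M[R[i]]_n :=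
  Vandermonde n (\row_k expi (theta k)).

Lemma norm_det_torus_Vandermonde {n : nat} (theta : 'I_n -> R) :
  `|\det (torus_Vandermonde theta)| ^+ 2 =
  ((\prod_(j < n) \prod_(k < n | (j < k)%N) 4) * class_vol theta)%:C%C.
Proof.
rewrite det_Vandermonde /class_vol -big_split /= normr_prod -prodrXl rmorph_prod.
apply: eq_bigr => j _; rewrite -big_split /= normr_prod -prodrXl rmorph_prod.
by apply: eq_bigr => k _; rewrite !mxE norm_expiB.
Qed.

Lemma gram_torus_VandermondeE {n : nat} (theta : 'I_n -> R) i j :
  (torus_Vandermonde theta *m (torus_Vandermonde theta)^t*) i j =
  \sum_k expi (theta k * (i%:R - j%:R)).
Proof.
rewrite mxE; apply: eq_bigr => k _; rewrite !mxE rmorphXn /=.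
by rewrite conj_expi !expiX -expiD mulNr mulrBr.
Qed.

Lemma torus_Vandermonde_le {n : nat} (theta : 'I_n -> R) :
  (0 < n)%N -> `|\det (torus_Vandermonde theta)| ^+ 2 <= n%:R ^+ n.
Proof.
move=> n_gt0; rewrite -det_gramC; apply: (le_trans (det_gram_le _)).
rewrite /mxtrace (eq_bigr (fun=> n%:R)) => [|i _]; last first.
  rewrite gram_torus_VandermondeE (eq_bigr (fun=> 1)) => [|k _].
    by rewrite sumr_const card_ord.
  by rewrite subrr mulr0 expi0.
by rewrite sumr_const card_ord -[X in X / _]mulr_natr mulfK // pnatr_eq0 -lt0n.
Qed.

(** A geometric sum of ratio [w = e^(2 pi i d / n)]: integrality of [d] gives [w ^+ n = 1], and
    [0 < |d| < n] gives [w != 1]. Here [d] will be the difference of two row indices, possibly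
    negative. *)
Lemma sum_expi_eq0 (n : nat) (d a : R) (m : int) :
  d = m%:~R -> 0 < `|d| < n%:R ->
  \sum_(k < n) expi ((a + 2 * pi * k%:R / n%:R) * d) = 0.
Proof.
move=> dE /andP[d_gt0 d_lt]; have n_gt0 : 0 < n%:R :> R := lt_trans d_gt0 d_lt.
have n_neq0 : n%:R != 0 :> R by rewrite gt_eqF.
pose w := expi (2 * pi * d / n%:R).
have wn : w ^+ n = 1 by rewrite expiX divfK // dE expi_2piz.
have w_neq1 : w - 1 != 0.
  rewrite subr_eq0 expi_neq1 // !normrM normfV !normr_nat (ger0_norm (pi_ge0 R)).
  rewrite divr_gt0 ?mulr_gt0 ?pi_gt0 //= ltr_pdivrMr //.
  by rewrite ltr_pM2l // mulr_gt0 ?pi_gt0.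
rewrite (eq_bigr (fun k : 'I_n => expi (a * d) * w ^+ k)) => [|k _].
  rewrite -mulr_sumr; apply/eqP; rewrite mulf_eq0; apply/orP; right.
  by rewrite -(mulrI_eq0 _ (mulfI w_neq1)) -subrX1 wn subrr.
by rewrite expiX -expiD; congr expi; field.
Qed.

Lemma equally_spaced_det {n : nat} (theta : 'I_n -> R) :
  equally_spaced (torus theta) ->
  `|\det (torus_Vandermonde theta)| ^+ 2 = n%:R ^+ n.
Proof.
move=> [a [s spaced]].
have expiE k : expi (theta (s k)) = expi (a + 2 * pi * k%:R / n%:R).
  by rewrite -spaced !mxE eqxx mulr1n.
(* Equal spacing fixes the angles only modulo [2 pi], so they can be exchanged under [expi] only
   after multiplication by an integer. *)
have expiMz (x y : R) (m : int) : expi x = expi y -> expi (x * m%:~R) = expi (y * m%:~R).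
  case: m => m xy; first by rewrite -!expiX xy.
  by rewrite NegzE mulrNz !mulrN -!conj_expi -!expiX xy.
rewrite -det_gramC (_ : _ *m _ = n%:R%:M) ?det_scalar //.
apply/matrixP => i j; rewrite gram_torus_VandermondeE [RHS]mxE.
rewrite (reindex_perm s) /=.
have ijE : (i%:R - j%:R : R) = (i%:Z - j%:Z)%:~R by rewrite rmorphB.
under eq_bigr => k _ do rewrite ijE (expiMz _ _ _ (expiE k)) -ijE.
have [->|i_neq_j] := eqVneq i j.
  under eq_bigr do rewrite subrr mulr0 expi0.
  by rewrite sumr_const card_ord.
rewrite (sum_expi_eq0 _ _ _ _ ijE) //.
rewrite normr_gt0 subr_eq0 eqr_nat i_neq_j /= ltr_norml.
have := ltn_ord i; have := ltn_ord j.
rewrite -!(ltr_nat R); have := ler0n R i; have := ler0n R j; lra.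
Qed.

Lemma equally_spaced_class_vol_max {n : nat} (theta0 : 'I_n -> R) :
  (0 < n)%N -> admissible theta0 -> equally_spaced (torus theta0) ->
  is_maximizer (@class_vol R n) theta0.
Proof.
move=> n_gt0 adm0 spaced0; split=> // theta _.
have := torus_Vandermonde_le theta n_gt0.
rewrite -(equally_spaced_det theta0 spaced0) !norm_det_torus_Vandermonde lecR.
by rewrite ler_pM2l //; apply: prodr_gt0 => j _; apply: prodr_gt0.
Qed.

Lemma spaced_angles_equally_spaced (n : nat) :
  equally_spaced (torus (spaced_angles R n)).
Proof.
(* For even [n], [pi (2k+1) / n = pi / n + 2 pi k / n]. *)
exists (if odd n then 0 else pi / n%:R), 1%g => k.
rewrite perm1 !mxE eqxx mulr1n /spaced_angles; congr expi.
by case: ifP => _; rewrite ?add0r // -mulrDl; congr (_ / _); ring.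
Qed.

Lemma spaced_angles_admissible (n : nat) :
  (0 < n)%N -> admissible (spaced_angles R n).
Proof.
move=> n_gt0; have nR_gt0 : 0 < n%:R :> R by rewrite ltr0n.
have n_neq0 : n%:R != 0 :> R by rewrite gt_eqF.
have pi_ge0 := pi_ge0 R; split.
- move=> k; have k_ge0 := ler0n R k.
  have : k.+1%:R <= n%:R :> R by rewrite ler_nat.
  rewrite -natr1 => k_le.
  rewrite /spaced_angles; case: ifP => _; apply/andP; split;
    by [apply: divr_ge0 => //; nra | rewrite ler_pdivrMr //; nra].
- move=> j k jk; have : j%:R <= k%:R :> R by rewrite ler_nat.
  by rewrite /spaced_angles => jkR; case: ifP => _;
    rewrite ler_pM2r ?invr_gt0 //; nra.
(* The angles [2 pi k / n] sum to [pi (n - 1)], a multiple of [2 pi] only for odd [n]; for even [n]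
   the shift by [pi / n] raises the sum to [pi n]. Both cases equal [2 pi] times [n./2]. *)
- exists (n./2 : int); rewrite /spaced_angles; have := odd_double_half n.
  rewrite -[_%:~R]/(n./2%:R); case: (odd n) => nE.
    have -> : n./2%:R = (n%:R - 1) / 2 :> R.
      by rewrite -{2}nE natrD -mul2n natrM /=; field.
    under eq_bigr do rewrite mulrAC.
    by rewrite -mulr_sumr sumr_ord; field.
  have -> : n./2%:R = n%:R / 2 :> R by rewrite -{2}nE add0n -mul2n natrM; field.
  under eq_bigr do rewrite mulrAC.
  rewrite -mulr_sumr big_split /= -mulr_sumr sumr_ord sumr_const card_ord.
  by field.
Qed.

End TorusVandermonde.

Theorem theorem3p1 (R : realType) (n : nat) (n_ge2 : (2 <= n)%N) :
  [/\ equally_spaced (torus (spaced_angles R n)),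
      is_maximizer (@class_vol R n) (spaced_angles R n),
      forall theta0 : 'I_n -> R,
        admissible theta0 -> equally_spaced (torus theta0) ->
        is_maximizer (@class_vol R n) theta0
    & forall vol : set 'M[R[i]]_n -> R, measures_classes vol ->
      forall theta0 : 'I_n -> R,
        admissible theta0 -> equally_spaced (torus theta0) ->
        is_maximizer (fun theta => vol (conj_class (torus theta))) theta0].
Proof.
have n_gt0 : (0 < n)%N := ltnW n_ge2.
have spaced := spaced_angles_equally_spaced R n.
split=> //.
- by apply: equally_spaced_class_vol_max => //; apply: spaced_angles_admissible.
- by move=> theta0; apply: equally_spaced_class_vol_max.
move=> vol [c c_gt0 volE] theta0 adm0 spaced0; split=> // theta adm.
rewrite !volE // ler_pM2l //.
by have [_] := equally_spaced_class_vol_max R theta0 n_gt0 adm0 spaced0; apply.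
Qed.
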